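(* Let $\mu$ be a countably additive Borel probability on $\Omega=\{0,1\}^{\mathbb N}$. If a probability function $P$ on the Borel $\sigma$-algebra $\mathcal B$ of $\Omega$ agrees with $\mu$ on every open set, then $P=\mu$ on every Borel set.
   Context: $\Omega=\{0,1\}^{\mathbb N}$ carries the product topology ($\{0,1\}$ discrete). A probability function on $\mathcal B$ is a map $P:\mathcal B\to[0,1]$ with $P(\Omega)=1$ and $P(A\cup B)=P(A)+P(B)$ for disjoint $A,B\in\mathcal B$; countable additivity is not assumed. *)

(* Defs.v *)
From mathcomp Require Import all_boot all_order all_algebra.
From mathcomp Require Import all_classical all_reals all_analysis.

Set Implicit Arguments.
Unset Strict Implicit.
Unset Printing Implicit Defensive.

Import Order.TTheory GRing.Theory Num.Theory.
Import numFieldNormedType.Exports.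

Local Open Scope classical_set_scope.
Local Open Scope ring_scope.

(* [cantor_space] is [nat -> bool] with the product of the discrete
   topologies; the [measurable] sets of [Omega] are the Borel sets of that
   topology. *)
Definition Omega := g_sigma_algebraType (@open cantor_space).

(* [P] is a total function on sets, of which only the values on measurable
   sets are constrained. *)
Record probability_function d (T : measurableType d) (R : realType)
    (P : set T -> R) : Prop := {
  probability_function_itv : forall A, measurable A -> 0 <= P A <= 1 ;
  probability_function_setT : P setT = 1 ;
  probability_function_setU : forall A B, measurable A -> measurable B ->
    A `&` B = set0 -> P (A `|` B) = P A + P B }.

(* Main.v *)
(** By countable additivity, the sets which are outer regular for [mu] (that is,
    approximable from outside by open sets up to arbitrarily small measure) are
    closed under countable unions and countable intersections. The topology of
    the Cantor space comes from a uniformity with a countable base, so closed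
    sets are countable intersections of open sets, hence outer regular, and
    therefore every Borel set is outer regular. Monotonicity of [P] then gives
    [P A <= P U = mu U <= mu A + e] for some open [U] containing [A], so
    [P <= mu] on Borel sets; applying this to the complement gives equality. *)
Require Import Defs.
From mathcomp Require Import all_boot all_order all_algebra.
From mathcomp Require Import all_classical all_reals all_analysis borel_hierarchy.

Set Implicit Arguments.
Unset Strict Implicit.
Unset Printing Implicit Defensive.

Import Order.TTheory GRing.Theory Num.Theory.

Local Open Scope classical_set_scope.
Local Open Scope ring_scope.

(** With [f] a countable base of entourages, [A] is the intersection of the interiors of its
    [f n]-thickenings: a point lying in all of them is in the closure of [A]. *)
Lemma closed_Gdelta (T : uniformType) (A : set T) :
  countable_uniformity T -> closed A -> Gdelta A.
Proof.
move=> /countable_uniformityP[f fE entf] cA.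
exists (fun n => (\bigcup_(y in A) xsection (f n) y)^°).
  by move=> n; exact: open_interior.
apply/seteqP; split=> [x Ax n _|x Ax].
- by apply: filterS (nbhs_entourage x (entf n)) => y fxy; exists x.
- apply: cA => B; rewrite -nbhs_entourageE => -[E entE EB].
  (* The thickening provides [(y, x)] in [f n], while a neighbourhood of [x] asks for [(x, y)] in
     [E]; hence the inverse entourage. *)
  have [n fnE] := fE _ (entourage_inv entE).
  have /interior_subset[y Ay] := Ax n Logic.I.
  rewrite /xsection/= inE => /fnE Exy.
  by exists y; split=> //; apply: EB; rewrite /xsection/= inE.
Qed.

Lemma cantor_closed_Gdelta (R : realType) (A : set cantor_space) :
  closed A -> Gdelta A.
Proof.
apply: closed_Gdelta.
exact: (@countable_uniformity_metric R (prod_topology (fun _ : nat => bool))).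
Qed.

Section outer_regularity.
Context (T : ptopologicalType) (R : realType).
Let X := g_sigma_algebraType (@open T).
Context (mu : {finite_measure set X -> \bar R}).

(** Bounding [mu (U]\[A)], rather than comparing [mu U] with [mu A], lets the errors of a sequence
    of sets add up by subadditivity. *)
Definition outer_regular (A : set X) :=
  measurable A /\
  forall e : R, 0 < e ->
    exists U : set X, [/\ @open T U, A `<=` U & (mu (U `\` A) <= e%:E)%E].

Lemma open_Borel (U : set X) : @open T U -> measurable U.
Proof. exact: sub_sigma_algebra. Qed.

Lemma open_outer_regular (U : set X) : @open T U -> outer_regular U.
Proof.
move=> oU; split=> [|e e0]; first exact: open_Borel.
by exists U; split=> //; rewrite setDv measure0 lee_fin ltW.
Qed.

(** The [n]-th error is [e / 2 ^ n.+1], and these sum to [e]. The set [D] is left free so that the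
    same bound serves unions and intersections. *)
Lemma outer_regular_approx (A : (set X)^nat) (e : R) : 0 < e ->
  (forall n, outer_regular (A n)) ->
  exists U : (set X)^nat,
    [/\ forall n, @open T (U n), forall n, A n `<=` U n &
        forall D : set X, measurable D ->
          D `<=` \bigcup_n (U n `\` A n) -> (mu D <= e%:E)%E].
Proof.
move=> e0 rA.
have /choice[U UA] n : exists U : set X, [/\ @open T U, A n `<=` U &
    (mu (U `\` A n) <= (e / (2 ^ n.+1)%:R)%:E)%E].
  by apply: (rA n).2; rewrite divr_gt0// ltr0n expn_gt0.
exists U; split=> [n|n|D mD DUA]; [by case: (UA n)|by case: (UA n)|].
apply: le_trans (measure_sigma_subadditive mu _ mD DUA) _ => [n|].
  case: (UA n) => oU _ _.
  by apply: measurableD; [exact: open_Borel|exact: (rA n).1].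
apply: le_trans (epsilon_trick0 xpredT (ltW e0)).
by apply: lee_nneseries => // n _; case: (UA n).
Qed.

Lemma bigcup_outer_regular (A : (set X)^nat) :
  (forall n, outer_regular (A n)) -> outer_regular (\bigcup_n A n).
Proof.
move=> rA; have mA : measurable (\bigcup_n A n).
  by apply: bigcupT_measurable => n; exact: (rA n).1.
split=> // e e0; have [U [oU AU mU]] := outer_regular_approx e0 rA.
have oUU : @open T (\bigcup_n U n) by exact: bigcup_open.
exists (\bigcup_n U n); split=> //.
  by apply: subset_bigcup => n _; exact: AU.
apply: mU; first by apply: measurableD => //; exact: open_Borel.
by move=> x [[n _ Ux] nAx]; exists n => //; split=> // Ax; apply: nAx; exists n.
Qed.

(** The intersection of the [U n] need not be open, so it is replaced by a finite one [V N].
    Continuity of [mu] from above makes this cost at most [e / 2]; the other half pays for passing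
    from the [A n] to the [U n]. *)
Lemma bigcap_outer_regular (A : (set X)^nat) :
  (forall n, outer_regular (A n)) -> outer_regular (\bigcap_n A n).
Proof.
move=> rA; have mA : measurable (\bigcap_n A n).
  by apply: bigcapT_measurable => n; exact: (rA n).1.
split=> // e e0; have e20 : 0 < e / 2 by rewrite divr_gt0.
have [U [oU AU mU]] := outer_regular_approx e20 rA.
have mUn n : measurable (U n) by exact: open_Borel.
pose V n : set X := \bigcap_(i < n) U i.
have oV n : @open T (V n).
  elim: n => [|n IHn]; first by rewrite /V bigcap_mkord big_ord0; exact: openT.
  rewrite /V bigcap_mkord big_ord_recr/= -bigcap_mkord; exact: openI.
have VU : \bigcap_n V n = \bigcap_n U n.
  (* [V n] only involves indices below [n], so [U n] is first reached in [V n.+1]. *)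
  apply/seteqP; split=> x; first by move=> Vx n _; apply: (Vx n.+1 I) => /=.
  by move=> Ux n _ i _; exact: Ux.
have mUU : measurable (\bigcap_n U n) by exact: bigcapT_measurable.
pose F n := V n `\` \bigcap_n U n.
have mF n : measurable (F n) by apply: measurableD => //; exact: open_Borel.
have F0 : \bigcap_n F n = set0.
  rewrite -subset0 => x Fx; have [_] := Fx 0%N Logic.I.
  by apply; rewrite -VU => n _; exact: (Fx n Logic.I).1.
have : mu \o F @ \oo --> mu (\bigcap_n F n).
  apply: nonincreasing_cvg_mu => //.
  - by rewrite ltey_eq fin_num_measure.
  - by rewrite F0.
  - move=> m n mn; apply/subsetPset => x [Vx nUx]; split=> // i im.
    by apply: Vx => /=; exact: leq_trans mn.
rewrite F0 measure0 => /fine_cvgP[_ /cvgrPdist_le/(_ _ e20)[N _]].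
move=> /(_ N (leqnn _)).
rewrite /= sub0r normrN ger0_norm ?fine_ge0// => FN.
exists (V N); split=> //.
  by move=> x Ax i _; apply: AU; exact: Ax.
have mUA : measurable (\bigcap_n U n `\` \bigcap_n A n) by exact: measurableD.
have -> : V N `\` \bigcap_n A n = F N `|` (\bigcap_n U n `\` \bigcap_n A n).
  apply: setDU; last by rewrite -VU; exact: bigcap_inf.
  by apply: subset_bigcap => n _; exact: AU.
apply: le_trans (measureU2 _ _ _) _ => //.
rewrite [e]splitr EFinD; apply: leeD.
  by rewrite -[leLHS]fineK ?fin_num_measure// lee_fin.
apply: mU => // x [Ux /existsNP[n /not_implyP[_ nAx]]].
by exists n => //; split=> //; exact: Ux.
Qed.

(** The sets that are outer regular together with their complement form a sigma-algebra: closure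
    under complement is built in, and the complement of a countable union is a countable
    intersection. The hypothesis puts open sets in this class. *)
Lemma Borel_outer_regular :
  (forall A : set T, closed A -> Gdelta A) ->
  forall A : set X, measurable A -> outer_regular A.
Proof.
move=> cG; suff h : @measurable _ X `<=`
    [set A | outer_regular A /\ outer_regular (~` A)].
  by move=> A /h[].
apply: smallest_sub => [|U oU]; last first.
  split; first exact: open_outer_regular.
  have [F oF ->] := cG _ (open_closedC oU).
  by apply: bigcap_outer_regular => n; exact: open_outer_regular.
split=> [|A [rA rCA]|A rA].
- split; first by apply: open_outer_regular; exact: open0.
  by rewrite setC0; apply: open_outer_regular; exact: openT.
- by rewrite setTD; split=> /=; rewrite ?setCK.
- split; first by apply: bigcup_outer_regular => n; exact: (rA n).1.
  by rewrite setC_bigcup; apply: bigcap_outer_regular => n; exact: (rA n).2.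
Qed.

End outer_regularity.

Section probability_function_lemmas.
Context d (T : measurableType d) (R : realType) (P : set T -> R)
  (hP : probability_function P).

Lemma probability_function_le (A B : set T) :
  measurable A -> measurable B -> A `<=` B -> P A <= P B.
Proof.
move=> mA mB AB; have mBA : measurable (B `\` A) by exact: measurableD.
rewrite -(setDUK AB) (probability_function_setU hP)// ?setDIK//.
by rewrite lerDl; case/andP: (probability_function_itv hP mBA).
Qed.

Lemma probability_function_setC (A : set T) :
  measurable A -> P (~` A) = 1 - P A.
Proof.
move=> mA; rewrite -(probability_function_setT hP) -(setUv A).
rewrite (probability_function_setU hP) ?setICr//; last exact: measurableC.
by rewrite addrC addKr.
Qed.

End probability_function_lemmas.

Theorem proposition7p1 (R : realType) (mu : probability Omega R)
    (P : set Omega -> R) (hP : probability_function P)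
    (hopen : forall U : set Omega, @open cantor_space U -> (P U)%:E = mu U) :
  forall A : set Omega, measurable A -> (P A)%:E = mu A.
Proof.
have P_le A : measurable A -> ((P A)%:E <= mu A)%E.
  move=> mA; apply/lee_addgt0Pr => e e0.
  have [_ /(_ _ e0)[U [oU AU UAe]]] :=
    @Borel_outer_regular cantor_space R mu (@cantor_closed_Gdelta R) A mA.
  have mU : measurable U by exact: open_Borel.
  apply: (@le_trans _ _ (mu U)).
    by rewrite -hopen// lee_fin; exact: probability_function_le.
  rewrite -(setDUK AU) measureU ?setDIK//; last exact: measurableD.
  exact: leeD.
move=> A mA; apply/eqP; rewrite eq_le P_le//=.
(* On the complement the bound reads [1 - P A <= 1 - mu A], the missing inequality. *)
have := P_le _ (measurableC mA).
rewrite (probability_function_setC hP)// probability_setC// EFinB.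
by rewrite -(fineK (fin_num_measure mu A mA)) -!EFinB !lee_fin lerD2l lerN2.
Qed.
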